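(* Let $F\colon C_+\to C_+$, $F_i(x)=x_if_i(x)$, where $f\colon C_+\to C_+$ is continuous, $f(x)\gg0$ for all $x\in C_+$, and $f_i(\mathbf e_i)=1$ for all $i$. Let $\varkappa>0$, $\Lambda=[0,(1+\varkappa)\mathbf e]$, and assume that $F{\restriction}_\Lambda\colon\Lambda\to F(\Lambda)$ is a local homeomorphism and that $F$ is weakly retrotone in $\Lambda$. Assume moreover that at least one of the following holds: (α) for any $x,y\in C_+$ with $x<y$: $f_i(x)\ge f_i(y)$ for all $i$, and $f_i(x)>f_i(y)$ for those $i$ with $x_i<y_i$; (β) for any $x,y\in\Lambda$ with $F(x)<F(y)$: $f_i(x)\ge f_i(y)$ for all $i$, and for those $i$ with $F_i(x)<F_i(y)$ either $x_i=0$ or $f_i(x)>f_i(y)$. Let $S_*$, $S^*$ be the pointwise radial limits and $\widetilde S$, $\check S$ the Kuratowski limits of the increasing sequence $(S_n)$ and the decreasing sequence $(S^n)$ of weakly unordered hypersurfaces constructed in the context. Then $$S_*=\widetilde S=\check S=S^*.$$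
   Context: Notation: $C_+=\{x\in\mathbb R^d:x_i\ge0\ \forall i\}$; $\mathbf e_i$ standard basis vectors, $\mathbf e=\sum_i\mathbf e_i$; $x\le y$ coordinatewise, $x<y$ if $x\le y$ and $x\ne y$, $x\ll y$ if $x_i<y_i$ for all $i$; $[x,y]=\{z\in C_+:x\le z\le y\}$. $\Delta=\{x\in C_+:\sum_ix_i=1\}$. ''Local homeomorphism'' onto $F(\Lambda)$: each $x\in\Lambda$ has a relatively open neighbourhood $U$ in $\Lambda$ mapped homeomorphically by $F$ onto a relatively open neighbourhood of $F(x)$ in $F(\Lambda)$. $F$ is weakly retrotone in $B$ if for all $I\subset\{1,\dots,d\}$ and $x,y\in B$: $F(x)<F(y)$ and $F_i(x)<F_i(y)$ for all $i\in I$ imply $x<y$ and $x_i<y_i$ for all $i\in I$. If $S\subset C_+\setminus\{0\}$ is such that the radial projection $x\mapsto x/\|x\|_1$ maps $S$ homeomorphically onto $\Delta$, its radial representation is the continuous function $R\colon\Delta\to(0,\infty)$ with $S=\{R(u)u:u\in\Delta\}$. Construction. Under the hypotheses $F(\Lambda)\subset\Lambda$ and $f_i(0)>1$ for all $i$. Choose $\varepsilon\in(0,1)$ so small that $\min_i f_i(x)>1$ for all $x\in C_+$ with $\sum_ix_i\le\varepsilon$. Put $S_0:=\varepsilon\Delta$, $S_n:=F^n(S_0)$, and $S^0:=\{x\in\Lambda: x_k=1+\varkappa\text{ for some }k\}$ (the boundary of $\Lambda$ relative to $C_+$), $S^n:=F^n(S^0)$. Each $S_n$ and $S^n$ is a subset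 of $\Lambda\setminus\{0\}$ mapped homeomorphically onto $\Delta$ by radial projection; let $R_n$, $R^n$ be their radial representations. For each $u\in\Delta$, $(R_n(u))_n$ is strictly increasing with limit $R_*(u)\in(0,\infty)$, and $(R^n(u))_n$ is strictly decreasing with limit $R^*(u)\ge R_*(u)$. Put $S_*:=\{R_*(u)u:u\in\Delta\}$, $S^*:=\{R^*(u)u:u\in\Delta\}$. $\widetilde S$ is the Kuratowski limit of $(S_n)$: (K1) for each $x\in\widetilde S$ there are $x_n\in S_n$ with $x_n\to x$; (K2) whenever $x_{n_k}\in S_{n_k}$, $n_k\to\infty$, and $x_{n_k}\to x$, then $x\in\widetilde S$. $\check S$ is defined in the same way as the Kuratowski limit of $(S^n)$. (These limits exist, and are also the limits in the Hausdorff metric on nonempty compact subsets of $\Lambda$.) *)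

(* Defs.v *)
From HB Require Import structures.
From mathcomp Require Import all_boot all_order all_algebra.
From mathcomp Require Import all_classical all_reals all_analysis.

Set Implicit Arguments.
Unset Strict Implicit.
Unset Printing Implicit Defensive.

Import Order.TTheory GRing.Theory Num.Theory.
Import numFieldNormedType.Exports.

Local Open Scope classical_set_scope.
Local Open Scope ring_scope.

(* MathComp puts no order on 'rV[R]_d, so the three coordinatewise relations
   are defined here; as usual for cones, [x < y] is [x <= y] together with
   [x != y], not the strict inequality in every coordinate. *)
Section VectorOrder.
Variables (R : realType) (d : nat).
Implicit Types x y : 'rV[R]_d.

Definition vle x y : Prop := forall i, x 0 i <= y 0 i.
Definition vlt x y : Prop := vle x y /\ x <> y.
Definition vll x y : Prop := forall i, x 0 i < y 0 i.

Definition Cplus : set 'rV[R]_d := [set x | forall i, 0 <= x 0 i].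

Definition order_interval x y : set 'rV[R]_d :=
  [set z | [/\ Cplus z, vle x z & vle z y]].

Definition Delta : set 'rV[R]_d := [set x | Cplus x /\ \sum_i x 0 i = 1].

Definition unit_vec (i : 'I_d) : 'rV[R]_d := delta_mx 0 i.

Definition Lambda (kappa : R) : set 'rV[R]_d :=
  order_interval 0 (const_mx (1 + kappa)).

End VectorOrder.

Section Topology.
Variables T U : topologicalType.

(* [g] restricts to a homeomorphism of the subspace [A] onto the subspace [B]. *)
Definition homeo_onto (g : T -> U) (A : set T) (B : set U) : Prop :=
  [/\ g @` A = B, {within A, continuous g} &
   exists h : U -> T, {within B, continuous h} /\ {in A, cancel g h}].

(* Relatively open subsets of [A] (resp. of [g @` A]) are written [A `&` V]
   (resp. [g @` A `&` W]) with [V] (resp. [W]) open in the ambient space. *)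
Definition local_homeo_onto_image (g : T -> U) (A : set T) : Prop :=
  forall x, A x -> exists (V : set T) (W : set U),
    [/\ open V, V x, open W, W (g x) &
     homeo_onto g (A `&` V) (g @` A `&` W)].

Definition kuratowski_limit (S : nat -> set T) (L : set T) : Prop :=
  (forall x, L x ->
     exists x_ : nat -> T, (forall n, S n (x_ n)) /\ (x_ @ \oo --> x)) /\
  (forall (k : nat -> nat) (x_ : nat -> T) x,
     k @ \oo --> \oo -> (forall j, S (k j) (x_ j)) -> x_ @ \oo --> x -> L x).

Lemma kuratowski_limit_unique (S : nat -> set T) (L M : set T) :
  kuratowski_limit S L -> kuratowski_limit S M -> L = M.
Proof.
move=> [L1 L2] [M1 M2]; apply/seteqP; split=> x.
- by move=> /L1[u [Su ux]]; apply: (M2 id u).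
- by move=> /M1[u [Su ux]]; apply: (L2 id u).
Qed.

End Topology.

Section Kolmogorov.
Variables (R : realType) (d : nat).
Implicit Types (f F : 'rV[R]_d -> 'rV[R]_d) (S : set 'rV[R]_d).

Definition kolmogorov f (x : 'rV[R]_d) : 'rV[R]_d :=
  \row_i (x 0 i * f x 0 i).

Definition weakly_retrotone F (B : set 'rV[R]_d) : Prop :=
  forall (I : {set 'I_d}) (x y : 'rV[R]_d), B x -> B y ->
    vlt (F x) (F y) -> (forall i, i \in I -> F x 0 i < F y 0 i) ->
    vlt x y /\ (forall i, i \in I -> x 0 i < y 0 i).

Definition condition_alpha f : Prop :=
  forall x y, Cplus x -> Cplus y -> vlt x y ->
    (forall i, f x 0 i >= f y 0 i) /\
    (forall i, x 0 i < y 0 i -> f x 0 i > f y 0 i).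

Definition condition_beta f (kappa : R) : Prop :=
  let F := kolmogorov f in
  forall x y, Lambda kappa x -> Lambda kappa y -> vlt (F x) (F y) ->
    (forall i, f x 0 i >= f y 0 i) /\
    (forall i, F x 0 i < F y 0 i -> x 0 i = 0 \/ f x 0 i > f y 0 i).

Definition small_radius f (eps : R) : Prop :=
  0 < eps < 1 /\
  (forall x, Cplus x -> \sum_i x 0 i <= eps -> forall i, 1 < f x 0 i).

(* [S_lower f eps n] is the increasing sequence S_n and [S_upper f kappa n]
   the decreasing sequence S^n. *)
Definition S_lower f (eps : R) (n : nat) : set 'rV[R]_d :=
  iter n (kolmogorov f) @` [set eps *: u | u in @Delta R d].

Definition S_upper f (kappa : R) (n : nat) : set 'rV[R]_d :=
  iter n (kolmogorov f) @`
    [set x | Lambda kappa x /\ exists k, x 0 k = 1 + kappa].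

(* Only the values of [rho] on [Delta] matter, and they are determined by [S]. *)
Definition radial_representation S (rho : 'rV[R]_d -> R) : Prop :=
  [/\ {within @Delta R d, continuous rho},
      forall u, Delta u -> 0 < rho u &
      S = [set rho u *: u | u in @Delta R d]].

Definition radial_limit_set (rho : nat -> 'rV[R]_d -> R) : set 'rV[R]_d :=
  [set limn (fun n => rho n u) *: u | u in @Delta R d].

End Kolmogorov.

(* Main.v *)
Require Import Defs.
From HB Require Import structures.
From mathcomp Require Import all_boot all_order all_algebra.
From mathcomp Require Import all_classical all_reals all_analysis.
From mathcomp Require Import lra.

Set Implicit Arguments.
Unset Strict Implicit.
Unset Printing Implicit Defensive.

Import Order.TTheory GRing.Theory Num.Theory.
Import numFieldNormedType.Exports.

Local Open Scope classical_set_scope.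
Local Open Scope ring_scope.

(** The proof combines the order structure of the hypersurfaces with a maximum
principle for ratios of coordinates.

Order. Say that [x] is below [y] when [x < y] and [x_i < y_i] on the support
of [y]. Weak retrotonicity, with [I] the support, says that [F] pulls this
relation back ([retrotone_below]), so every [S_n] and every [S^n], like the
simplex and the outer boundary of the box from which they start, contains no
two points one below the other. Two points of one ray at different
distances from the origin are comparable in this sense; hence if the graph of
[rho] lies radially under that of [rho'] and contains no comparable pair, then
the images are in the same radial order ([radial_le_image]). This single fact
gives, by induction, that [R_n] increases, that [R^n] decreases and that
[R_n <= R^n].

Ratios. Let [A] and [B] be the sets of limit points of [(S_n)] and [(S^n)].
By compactness each point of [A] has an [F]-preimage in [A], and likewise for
[B] ([outer_limit_preimage]). Let [l] be the largest number with
[l x <= y] for some [x] in [A] and [y] in [B]. If [l > 1], take preimages [x']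
and [y']: since [F x' < F y'], condition (beta) (which follows from (alpha) and
retrotonicity) gives [f_i x' > f_i y'] wherever [x_i > 0], so
[y'_i / x'_i = (y_i / x_i) (f_i x' / f_i y') > l] for all these [i], and [l] was
not maximal ([backward_invariant_le]). So [l <= 1]. Applied to the points of
[S_*] and [S^*] on a common ray, this is [R^* <= R_*].

Once the two radial limits agree, [R_m <= R_n, R^n <= R^m] for [m <= n] squeezes
both sequences of graphs, and a limit point of either can only lie on the
common radial limit ([kuratowski_limit_squeeze]). *)

(** * Limit points of a sequence of sets *)

Section Topology.
Variable (T : topologicalType).

Definition outer_limit (S : nat -> set T) : set T :=
  \bigcap_m closure (\bigcup_(n in [set n | (m <= n)%N]) S n).

Lemma closed_outer_limit (S : nat -> set T) : closed (outer_limit S).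
Proof. by apply: closed_bigI => m _; exact: closed_closure. Qed.

Lemma outer_limit_sub (S : nat -> set T) (K : set T) :
  closed K -> (forall n, S n `<=` K) -> outer_limit S `<=` K.
Proof.
move=> Kcl SK x /(_ 0%N I) Sx; rewrite (closure_id K).1 //.
by apply: closureS Sx => y [n _ /SK].
Qed.

Lemma outer_limit_cvg (S : nat -> set T) (x_ : nat -> T) (x : T) :
  (forall n, S n (x_ n)) -> x_ @ \oo --> x -> outer_limit S x.
Proof.
move=> Sx xx m _ V /xx [N _ NV].
exists (x_ (maxn m N)); split; last by apply: NV; rewrite /= leq_maxr.
by exists (maxn m N) => //=; rewrite leq_maxl.
Qed.

(** The sets where [g] is close to [x], cut down to the late [S n], form a
filter base on the compact set [K]; any cluster point of it is again a limit
point of the sequence, and continuity forces [g] to send it to [x]. *)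
Lemma outer_limit_preimage (g : T -> T) (K : set T) (S : nat -> set T) (x : T) :
  hausdorff_space T -> compact K -> {within K, continuous g} ->
  (forall n, S n `<=` K) -> (forall n, S n.+1 = g @` S n) ->
  outer_limit S x -> exists2 x', outer_limit S x' & g x' = x.
Proof.
move=> hT Kco /subspace_continuousP gK SK Sg Sx.
pose B (p : set T * nat) :=
  g @^-1` p.1 `&` \bigcup_(n in [set n | (p.2 <= n)%N]) S n.
pose G := filter_from [set p : set T * nat | nbhs x p.1] B.
have GB V m : nbhs x V -> G (B (V, m)) by move=> xV; exists (V, m).
have GP : ProperFilter G.
  apply: filter_from_proper; first apply: filter_from_filter.
  - by exists (setT, 0%N); exact: filterT.
  - move=> [V m] [W k] /= xV xW.
    exists (V `&` W, maxn m k); first exact: filterI.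
    move=> z [[Vz Wz] [n /= mn Sn]].
    by split; split=> //; exists n => //=; apply: leq_trans mn;
      rewrite ?leq_maxl ?leq_maxr.
  - move=> [V m] /= xV; have [y [[[|n] //= mn Sy] Vy]] := Sx m.+1 I V xV.
    move: Sy Vy; rewrite Sg => -[z Sz <-] Vgz.
    by exists z; split=> //; exists n.
have GK : G K.
  by exists (setT, 0%N) => [|z [_ [n _ /SK]]//]; exact: filterT.
have [p [Kp clp]] := Kco G GP GK.
exists p.
  move=> m _ V pV.
  by have [z [[_ Sz] Vz]] := clp _ _ (GB setT m filterT) pV; exists z.
apply: hT => V W pV xW.
have [z [[Wz [n _ /SK Kz]] /(_ Kz) Vz]] := clp _ _ (GB W 0%N xW) (gK p Kp V pV).
by exists (g z).
Qed.

End Topology.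

(** * Continuity on the box *)

Section Cone.
Variables (R : realType) (d : nat).
Implicit Types (f : 'rV[R]_d -> 'rV[R]_d) (x y z u v : 'rV[R]_d).
Implicit Types (S : set 'rV[R]_d) (rho : 'rV[R]_d -> R).

Lemma cvg_row (T : Type) (G : set_system T) (FG : Filter G)
    (h : T -> 'rV[R]_d) (l : 'rV[R]_d) :
  (forall i, h t 0 i @[t --> G] --> l 0 i) -> h @ G --> l.
Proof.
move=> hl V [P lP PV]; rewrite /= nbhs_simpl.
have : \forall t \near G, forall i, P 0 i (h t 0 i).
  by apply: filter_forall => i; exact: hl (lP 0 i).
by apply: filterS => t Pt; apply: PV => i j; rewrite ord1.
Qed.

Lemma LambdaP (kappa : R) :
  Lambda kappa = [set x : 'rV[R]_d | forall i, `[0, 1 + kappa]%classic (x 0 i)].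
Proof.
apply/seteqP; split=> x.
  by move=> [x0 _ x1] i /=; have := x1 i; rewrite mxE in_itv /= x0.
move=> xk; have xk' i : 0 <= x 0 i <= 1 + kappa by have := xk i; rewrite /= in_itv.
by split=> i; rewrite ?mxE; have /andP[] := xk' i.
Qed.

Lemma Lambda_compact (kappa : R) : compact (@Lambda R d kappa).
Proof.
rewrite LambdaP.
have := @rV_compact R d (fun=> `[0, 1 + kappa]%classic).
by apply=> i; exact: segment_compact.
Qed.

Lemma Lambda_closed (kappa : R) : closed (@Lambda R d kappa).
Proof. exact: compact_closed (@norm_hausdorff _ _) (@Lambda_compact kappa). Qed.

Lemma sum_coord_continuous : continuous (fun x : 'rV[R]_d => \sum_i x 0 i).
Proof.
apply: continuous_big => [|i _]; first exact: add_continuous.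
exact: coord_continuous.
Qed.

Lemma Lambda_ge0 (kappa : R) x i : Lambda kappa x -> 0 <= x 0 i.
Proof. by case. Qed.

Lemma Lambda_le (kappa : R) x i : Lambda kappa x -> x 0 i <= 1 + kappa.
Proof. by case=> _ _ /(_ i); rewrite mxE. Qed.

Lemma kolmogorov_continuous f (kappa : R) :
  {within @Cplus R d, continuous f} ->
  {within Lambda kappa, continuous (kolmogorov f)}.
Proof.
move=> /subspace_continuousP fC; apply/subspace_continuousP => x Lx.
apply: cvg_row => i; rewrite /kolmogorov mxE.
under eq_fun do rewrite mxE.
have Cx : Cplus x by case: Lx.
have sub : within (Lambda kappa) (nbhs x) --> within (@Cplus R d) (nbhs x).
  move=> V; rewrite !nbhs_simpl => xV.
  by apply: (@filterS _ (nbhs x) _ _ _ _ xV) => z /= Vz [/Vz].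
have xi : y 0 i @[y --> within (Lambda kappa) (nbhs x)] --> x 0 i.
  have := @coord_continuous R 1 d 0 i x; by apply: cvg_comp; exact: cvg_within.
apply: cvgM => //.
have fx : f y @[y --> within (Lambda kappa) (nbhs x)] --> f x.
  by apply: cvg_trans (fC x Cx); exact: cvg_app.
have := @coord_continuous R 1 d 0 i (f x); exact: cvg_comp.
Qed.

(** * The order pulled back by a weakly retrotone map *)

(** Strictness is required on the support of the larger vector only. Being
strictly smaller in every coordinate would say nothing about the part of a
hypersurface lying in the boundary of the cone, while [vlt] alone holds between
some points of the outer boundary of the box. *)
Definition below x y : Prop :=
  vlt x y /\ forall i, 0 < y 0 i -> x 0 i < y 0 i.

Definition below_free S : Prop := forall x y, S x -> S y -> ~ below x y.

Lemma vle_below x y z : vle x y -> below y z -> below x z.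
Proof.
move=> xy [[yz y_neq_z] yzlt]; split; last first.
  by move=> i /yzlt; exact: le_lt_trans.
split=> [i|xz]; first exact: le_trans (xy i) (yz i).
by apply: y_neq_z; apply/rowP => i; apply: le_anti; rewrite yz -xz xy.
Qed.

Lemma Delta_gt0 u : Delta u -> exists i, 0 < u 0 i.
Proof.
move=> [u0 u1]; apply: contrapT => nu.
have : \sum_i u 0 i <= 0.
  by apply: sumr_le0 => i _; rewrite leNgt; apply/negP => ui; apply: nu; exists i.
by rewrite u1 ler10.
Qed.

Lemma sum_scale_Delta (t : R) u : Delta u -> \sum_i (t *: u) 0 i = t.
Proof.
by move=> [_ u1]; under eq_bigr do rewrite mxE; rewrite -mulr_sumr u1 mulr1.
Qed.

Lemma scale_below (s t : R) u : Delta u -> 0 <= s < t -> below (s *: u) (t *: u).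
Proof.
move=> Du /andP[s0 st]; have [i ui] := Delta_gt0 Du; case: Du => u0 _.
have t0 : 0 < t by exact: le_lt_trans st.
split; [split|] => [j||j]; rewrite ?mxE.
- by rewrite ler_wpM2r ?(ltW st)//; exact: u0.
- by move=> /rowP/(_ i)/eqP; rewrite !mxE lt_eqF // ltr_pM2r.
- by rewrite pmulr_rgt0 // => uj; rewrite ltr_pM2r.
Qed.

Lemma rate_gt0 f (kappa : R) x i :
  (forall x, Cplus x -> vll 0 (f x)) -> Lambda kappa x -> 0 < f x 0 i.
Proof. by move=> fpos [/fpos/(_ i)]; rewrite mxE. Qed.

(** Since the rates are positive, [y] and [F y] have the same support, which is
the index set to which retrotonicity is applied. *)
Lemma retrotone_below f (kappa : R) x y :
  (forall x, Cplus x -> vll 0 (f x)) ->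
  weakly_retrotone (kolmogorov f) (Lambda kappa) ->
  Lambda kappa x -> Lambda kappa y ->
  below (kolmogorov f x) (kolmogorov f y) -> below x y.
Proof.
move=> fpos Fretro Lx Ly [Fxy Flt].
have [|xy lt] := Fretro [set i | 0 < y 0 i]%SET x y Lx Ly Fxy.
  move=> i; rewrite inE => yi; apply: Flt.
  by rewrite mxE mulr_gt0// (rate_gt0 _ _ Ly).
by split=> // i yi; apply: lt; rewrite inE.
Qed.

Lemma below_free_image f (kappa : R) S :
  (forall x, Cplus x -> vll 0 (f x)) ->
  weakly_retrotone (kolmogorov f) (Lambda kappa) ->
  S `<=` Lambda kappa -> below_free S -> below_free (kolmogorov f @` S).
Proof.
move=> fpos Fretro SL Sfree _ _ [x Sx <-] [y Sy <-].
by move=> /(retrotone_below fpos Fretro (SL _ Sx) (SL _ Sy)); exact: Sfree.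
Qed.

Lemma radial_mem S rho u : radial_representation S rho -> Delta u ->
  S (rho u *: u).
Proof. by move=> [_ _ ->] Du; exists u. Qed.

(** If [sigma' u < sigma u], then the points of the two image graphs on the ray
of [u] are one below the other, and so are their preimages [y] and [x]. Sliding
[y] down its own ray to the graph of [rho] keeps it below [x], which gives two
comparable points of [S]. *)
Lemma radial_le_image f (kappa : R) S S' (rho rho' sigma sigma' : 'rV[R]_d -> R) :
  (forall x, Cplus x -> vll 0 (f x)) ->
  weakly_retrotone (kolmogorov f) (Lambda kappa) ->
  S `<=` Lambda kappa -> S' `<=` Lambda kappa -> below_free S ->
  radial_representation S rho -> radial_representation S' rho' ->
  radial_representation (kolmogorov f @` S) sigma ->
  radial_representation (kolmogorov f @` S') sigma' ->
  (forall u, Delta u -> rho u <= rho' u) ->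
  forall u, Delta u -> sigma u <= sigma' u.
Proof.
move=> fpos Fretro SL SL' Sfree rS rS' rFS rFS' rho_le u Du.
rewrite leNgt; apply/negP => lt_sigma.
have [y S'y Fy] := radial_mem rFS' Du; have [x Sx Fx] := radial_mem rFS Du.
have yx : below y x.
  apply: (retrotone_below fpos Fretro (SL' _ S'y) (SL _ Sx)).
  rewrite Fy Fx; apply: scale_below => //; rewrite lt_sigma andbT.
  by case: rFS' => _ /(_ u Du)/ltW.
have [v Dv vy] : exists2 v, Delta v & rho' v *: v = y.
  by case: rS' S'y => _ _ -> [v Dv <-]; exists v.
apply: Sfree (radial_mem rS Dv) Sx (vle_below _ yx) => i.
by rewrite -vy !mxE ler_wpM2r ?rho_le//; case: Dv.
Qed.

(** Retrotonicity turns an inequality between images, as in (beta), into one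
between the points themselves, to which (alpha) applies. *)
Lemma condition_alpha_beta f (kappa : R) :
  weakly_retrotone (kolmogorov f) (Lambda kappa) ->
  condition_alpha f -> condition_beta f kappa.
Proof.
move=> Fretro alpha F x y Lx Ly Fxy.
have [Cx Cy] : Cplus x /\ Cplus y by case: Lx; case: Ly.
have [|xy xylt] := Fretro
    [set i | kolmogorov f x 0 i < kolmogorov f y 0 i]%SET x y Lx Ly Fxy.
  by move=> i; rewrite inE.
have [fle flt] := alpha x y Cx Cy xy.
by split=> // i Fi; right; apply/flt/xylt; rewrite inE.
Qed.

Lemma unit_vecE i j : unit_vec R i 0 j = (j == i :> 'I_d)%:R.
Proof. by rewrite mxE eqxx. Qed.

(** The axial fixed point [e_i] serves as a barrier: if [F_i x > 1] then
[F e_i < F x], so (beta) gives [f_i x < f_i e_i = 1] and [F_i x < x_i]. Thus no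
coordinate is pushed above [1 + kappa]. *)
Lemma kolmogorov_Lambda f (kappa : R) x :
  (forall x, Cplus x -> vll 0 (f x)) -> (forall i, f (unit_vec R i) 0 i = 1) ->
  0 < kappa ->
  weakly_retrotone (kolmogorov f) (Lambda kappa) -> condition_beta f kappa ->
  Lambda kappa x -> Lambda kappa (kolmogorov f x).
Proof.
move=> fpos fax k0 Fretro beta Lx.
have x0 i : 0 <= x 0 i := Lambda_ge0 i Lx.
have Fx0 i : 0 <= kolmogorov f x 0 i.
  by rewrite mxE mulr_ge0// ltW// (rate_gt0 _ _ Lx).
suff Fx1 i : kolmogorov f x 0 i <= 1 + kappa.
  by split=> [i|i|i]; rewrite ?[const_mx _ _ _]mxE ?[(0 : matrix _ _ _) _ _]mxE.
rewrite leNgt; apply/negP => Fxi.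
have F1 : 1 < kolmogorov f x 0 i by apply: lt_trans Fxi; lra.
have Fe : kolmogorov f (unit_vec R i) = unit_vec R i.
  apply/rowP => j; rewrite mxE unit_vecE.
  by case: eqVneq => [->|_]; rewrite ?mul0r // fax mul1r.
have Le : Lambda kappa (unit_vec R i).
  by split=> j; rewrite unit_vecE ?mxE; case: (_ == _) => /=; lra.
have eFx : vlt (kolmogorov f (unit_vec R i)) (kolmogorov f x).
  rewrite Fe; split=> [j|/rowP/(_ i)]; rewrite unit_vecE.
    by case: eqVneq => [->|_] /=; [exact: ltW|exact: Fx0].
  by rewrite eqxx => F1'; move: F1; rewrite -F1' ltxx.
have ei : kolmogorov f (unit_vec R i) 0 i = 1 by rewrite Fe unit_vecE eqxx.
have [_ /(_ i)] := beta _ _ Le Lx eFx.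
rewrite ei fax => /(_ F1)[|fx1].
  by rewrite unit_vecE eqxx /= => /eqP; rewrite oner_eq0.
suff : kolmogorov f x 0 i <= 1 + kappa by rewrite leNgt Fxi.
by rewrite mxE; apply: le_trans (Lambda_le i Lx); rewrite ler_piMr // ltW.
Qed.

(** * The maximum principle for ratios *)

(** The largest [l] with [l *: x <= y] on [A] times [B] exists by compactness,
the lower bound [c] keeping [A] away from the origin and hence [l] bounded.
Taking preimages strictly increases the ratio wherever [f] is strictly smaller
at the larger point, so a largest ratio above 1 is impossible. *)
Lemma backward_invariant_le f (kappa : R) (A B : set 'rV[R]_d) (c : R) :
  (forall x, Cplus x -> vll 0 (f x)) -> condition_beta f kappa -> 0 < c ->
  closed A -> closed B -> A `<=` Lambda kappa -> B `<=` Lambda kappa ->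
  (forall x, A x -> c <= \sum_i x 0 i) ->
  (forall x, A x -> exists2 x', A x' & kolmogorov f x' = x) ->
  (forall y, B y -> exists2 y', B y' & kolmogorov f y' = y) ->
  forall x y (l : R), A x -> B y -> vle (l *: x) y -> l <= 1.
Proof.
move=> fpos beta c0 Acl Bcl AL BL Ac Aback Bback x0 y0 l0 Ax0 By0 l0xy.
rewrite leNgt; apply/negP => l01.
(* Summing [l x_i <= y_i] over [i] gives [l c <= d (1 + kappa)]. *)
pose M := (\sum_(i < d) (1 + kappa)) / c.
have l_le_M l x y : A x -> B y -> 0 <= l -> vle (l *: x) y -> l <= M.
  move=> Ax By lge0 lxy; rewrite ler_pdivlMr //.
  apply: (@le_trans _ _ (\sum_i (l *: x) 0 i)).
    under eq_bigr do rewrite mxE.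
    by rewrite -mulr_sumr ler_wpM2l //; exact: Ac.
  by apply: ler_sum => i _; exact: le_trans (lxy i) (Lambda_le i (BL _ By)).
(* The condition [l x <= y] is closed in [(l, x, y)], whereas the largest such
   [l] is not a continuous function of [(x, y)]; so the maximum is taken over
   triples. *)
pose D := (`[1, M]%classic `*` (A `*` B)) `&`
  [set p : R * ('rV[R]_d * 'rV[R]_d) | vle (p.1 *: p.2.1) p.2.2].
have Dco : compact D.
  apply: compact_closedI.
    apply: compact_setX; first exact: segment_compact.
    have subLambda_compact := fun K Kcl =>
      @subclosed_compact _ K _ Kcl (@Lambda_compact kappa).
    by apply: compact_setX; exact: subLambda_compact.
  rewrite (_ : [set p | _] = \bigcap_(i in setT)
    (fun p : R * ('rV[R]_d * 'rV[R]_d) => p.2.2 0 i - p.1 * p.2.1 0 i) @^-1`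
    [set t | 0 <= t]); last first.
    apply/seteqP; split=> p /= h.
      by move=> i _ /=; have := h i; rewrite mxE subr_ge0.
    by move=> i; have := h i I; rewrite /= mxE subr_ge0.
  apply: closed_bigI => i _; apply: preimage_closed; last exact: closed_ge.
  move=> p _; apply: cvgB.
    have := @coord_continuous R 1 d 0 i p.2.2; apply: cvg_comp.
    by apply: cvg_comp; [exact: cvg_snd|exact: cvg_snd].
  apply: cvgM; first exact: cvg_fst.
  have := @coord_continuous R 1 d 0 i p.2.1; apply: cvg_comp.
  by apply: cvg_comp; [exact: cvg_snd|exact: cvg_fst].
have D_mem l x y : A x -> B y -> 1 < l -> vle (l *: x) y -> D (l, (x, y)).
  move=> Ax By l1 lxy; split=> //; split=> //=.
  by rewrite in_itv /= (ltW l1) (l_le_M _ x y)// ltW// (lt_trans ltr01).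
have D0 : D !=set0 by exists (l0, (x0, y0)); exact: D_mem.
have [[l [x y]] + lmax] := @compact_EVT_max _ _ fst D D0 Dco
  (continuous_subspaceT (fun p => cvg_fst)).
rewrite inE => -[[_ [/= Ax By]] lxy].
have l_gt1 : 1 < l.
  apply: lt_le_trans (l01) _; apply: (lmax (l0, (x0, y0))); rewrite inE.
  exact: D_mem.
have l_gt0 : 0 < l by exact: lt_trans l_gt1.
have [x' Ax' Fx'] := Aback x Ax; have [y' By' Fy'] := Bback y By.
have Lx' := AL _ Ax'; have Ly' := BL _ By'.
have fx' i : 0 < f x' 0 i := rate_gt0 i fpos Lx'.
have fy' i : 0 < f y' 0 i := rate_gt0 i fpos Ly'.
have xE i : x 0 i = x' 0 i * f x' 0 i by rewrite -Fx' mxE.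
have yE i : y 0 i = y' 0 i * f y' 0 i by rewrite -Fy' mxE.
have lxyi i : l * x 0 i <= y 0 i by have := lxy i; rewrite mxE.
have x_ge0 i : 0 <= x 0 i := Lambda_ge0 i (AL _ Ax).
have x_lt_y i : 0 < x 0 i -> x 0 i < y 0 i.
  by move=> xi; apply: lt_le_trans (lxyi i); rewrite ltr_pMl.
have [k xk] : exists k, 0 < x 0 k.
  apply: contrapT => nx; have := Ac x Ax; rewrite leNgt => /negP; apply.
  apply: le_lt_trans c0; apply: sumr_le0 => i _.
  by rewrite leNgt; apply/negP => xi; apply: nx; exists i.
have [f_le f_lt] : (forall i, f y' 0 i <= f x' 0 i) /\
    (forall i, 0 < x 0 i -> f y' 0 i < f x' 0 i).
  have [|fle flt] := beta x' y' Lx' Ly'.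
    rewrite Fx' Fy'; split=> [i|xy]; last by have := x_lt_y k xk; rewrite xy ltxx.
    by apply: le_trans (lxyi i); rewrite ler_peMl// ltW.
  split=> // i xi; have [|x'0|//] := flt i.
    by rewrite Fx' Fy'; exact: x_lt_y.
  by move: xi; rewrite xE x'0 mul0r ltxx.
(* The coordinates with [x'_i = 0] put no constraint on the ratio; on the
   finitely many others the inequality is strict, so there is room for a larger
   ratio [l']. The default value [l + 1] of the minimum only has to exceed [l]. *)
have lx'y' i : 0 < x' 0 i -> l < y' 0 i / x' 0 i.
  move=> x'i; rewrite ltr_pdivlMr //.
  have xi : 0 < x 0 i by rewrite xE mulr_gt0.
  rewrite -(ltr_pM2r (fy' i)) -yE; apply: lt_le_trans (lxyi i).
  by rewrite xE mulrA ltr_pM2l ?mulr_gt0 // f_lt.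
pose l' := \big[Num.min/l + 1]_(i | 0 < x' 0 i) (y' 0 i / x' 0 i).
have ll' : l < l' by apply: lt_bigmin => //; rewrite ltrDl.
have l'xy : vle (l' *: x') y'.
  move=> i; rewrite mxE; have := Lambda_ge0 i Lx'.
  rewrite le_eqVlt => /predU1P[<-|x'i]; first by rewrite mulr0 (Lambda_ge0 i Ly').
  by rewrite -ler_pdivlMr //; exact: bigmin_le_cond.
have : l' <= l.
  apply: (lmax (l', (x', y'))); rewrite inE; apply: D_mem => //.
  exact: lt_trans ll'.
by rewrite leNgt ll'.
Qed.

(** * Kuratowski limits of squeezed radial graphs *)

Lemma Delta_normalize x : Cplus x -> 0 < \sum_i x 0 i ->
  Delta ((\sum_i x 0 i)^-1 *: x).
Proof.
move=> Cx sx; split=> [i|].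
  by rewrite mxE mulr_ge0 ?invr_ge0 ?(ltW sx)//; exact: Cx.
by under eq_bigr do rewrite mxE; rewrite -mulr_sumr mulVf ?gt_eqF.
Qed.

(** Let [x_j] in [S (k j)] converge to [x]. Its radial coordinates [u_j] and
[rho (k j) u_j] converge to those, [u] and [s], of [x], because [c] keeps the
radii away from 0. For a fixed [m] the continuous bounds [lo m] and [hi m] can be
evaluated along [u_j], so [lo m u <= s <= hi m u]; letting [m] tend to infinity
identifies [s]. *)
Lemma kuratowski_limit_squeeze (rho lo hi : nat -> 'rV[R]_d -> R)
    (r : 'rV[R]_d -> R) (c : R) (S : nat -> set 'rV[R]_d) :
  0 < c ->
  (forall n, S n = [set rho n u *: u | u in @Delta R d]) ->
  (forall n u, Delta u -> c <= rho n u) ->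
  (forall n, {within @Delta R d, continuous (lo n)}) ->
  (forall n, {within @Delta R d, continuous (hi n)}) ->
  (forall m n u, (m <= n)%N -> Delta u -> lo m u <= rho n u <= hi m u) ->
  (forall u, Delta u -> lo n u @[n --> \oo] --> r u) ->
  (forall u, Delta u -> hi n u @[n --> \oo] --> r u) ->
  kuratowski_limit S [set r u *: u | u in @Delta R d].
Proof.
move=> c0 SE rho_c lo_c hi_c lohi lo_r hi_r; split.
  move=> _ [u Du <-]; exists (fun n => rho n u *: u); split.
    by move=> n; rewrite SE; exists u.
  apply: cvgZr_tmp.
  apply: squeeze_cvgr (lo_r u Du) (hi_r u Du).
  by near=> n; exact: lohi.
move=> k x_ x k_oo Sx xx.
have /choice[u_ u_P] : forall j, exists u, Delta u /\ rho (k j) u *: u = x_ j.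
  by move=> j; have := Sx j; rewrite SE => -[u Du ux]; exists u.
have Du j : Delta (u_ j) by have [] := u_P j.
have sxE j : \sum_i x_ j 0 i = rho (k j) (u_ j).
  by have [D <-] := u_P j; rewrite sum_scale_Delta.
pose s := \sum_i x 0 i.
have s_cvg : rho (k j) (u_ j) @[j --> \oo] --> s.
  under eq_cvg do rewrite -sxE.
  have := @sum_coord_continuous x; exact: cvg_comp.
have sc : c <= s.
  by apply: (cvgr_to_ge s_cvg); near=> j; exact: rho_c.
have s0 : 0 < s by exact: lt_le_trans sc.
have Cx : Cplus x.
  move=> i; have xi : x_ j 0 i @[j --> \oo] --> x 0 i.
    have := @coord_continuous R 1 d 0 i x; exact: cvg_comp.
  apply: (cvgr_to_ge xi); near=> j; have [[u0 _] <-] := u_P j.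
  by rewrite mxE mulr_ge0// ltW// (lt_le_trans c0)// rho_c.
have Dx := Delta_normalize Cx s0.
have u_cvg : u_ @ \oo --> s^-1 *: x.
  have uE j : u_ j = (rho (k j) (u_ j))^-1 *: x_ j.
    have [Duj ux] := u_P j; rewrite -ux scalerA mulVf ?scale1r//.
    by rewrite gt_eqF// (lt_le_trans c0)// rho_c.
  under eq_cvg do rewrite uE.
  by apply: cvgZ => //; apply: cvgV => //; rewrite gt_eqF.
have u_within : u_ @ \oo --> within (@Delta R d) (nbhs (s^-1 *: x)).
  move=> V; rewrite nbhs_simpl => /u_cvg.
  rewrite /= !nbhs_simpl => uV.
  apply: (@filterS _ \oo _ (fun j => Delta (u_ j) -> V (u_ j)) _ _ uV).
  by move=> j; apply; exact: Du.
have along (h : 'rV[R]_d -> R) : {within @Delta R d, continuous h} ->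
    h (u_ j) @[j --> \oo] --> h (s^-1 *: x).
  by move=> /subspace_continuousP/(_ _ Dx); apply: cvg_comp.
exists (s^-1 *: x) => //; rewrite -[RHS](scale1r x) scalerA.
suff -> : r (s^-1 *: x) = s by rewrite mulfV ?gt_eqF.
have k_ge m : \forall j \near \oo, (m <= k j)%N.
  by have := k_oo _ (nbhs_infty_ge m).
apply: le_anti; apply/andP; split.
  apply: (cvgr_to_le (lo_r _ Dx)); near=> m.
  apply: (ler_cvg_to (along _ (lo_c m)) s_cvg); near=> j => /=.
  have mk : (m <= k j)%N by near: j.
  by have /andP[] := lohi m (k j) (u_ j) mk (Du j).
apply: (cvgr_to_ge (hi_r _ Dx)); near=> m.
apply: (ler_cvg_to s_cvg (along _ (hi_c m))); near=> j => /=.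
have mk : (m <= k j)%N by near: j.
by have /andP[] := lohi m (k j) (u_ j) mk (Du j).
Unshelve. all: by end_near. Qed.

End Cone.

(** * Equality of the limits *)

Theorem theorem2p26 (R : realType) (d : nat)
  (f : 'rV[R]_d -> 'rV[R]_d) (kappa eps : R)
  (Rlow Rup : nat -> 'rV[R]_d -> R)
  (hd : (0 < d)%N)
  (f_cont : {within @Cplus R d, continuous f})
  (f_pos : forall x, Cplus x -> vll 0 (f x))
  (f_axial : forall i : 'I_d, f (unit_vec R i) 0 i = 1)
  (kappa_gt0 : 0 < kappa)
  (F_homeo : local_homeo_onto_image (kolmogorov f) (Lambda kappa))
  (F_retro : weakly_retrotone (kolmogorov f) (Lambda kappa))
  (f_alpha_or_beta : condition_alpha f \/ condition_beta f kappa)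
  (eps_small : small_radius f eps)
  (Rlow_rep : forall n, radial_representation (S_lower f eps n) (Rlow n))
  (Rup_rep : forall n, radial_representation (S_upper f kappa n) (Rup n)) :
  exists Stilde Scheck : set 'rV[R]_d,
    [/\ kuratowski_limit (S_lower f eps) Stilde,
        kuratowski_limit (S_upper f kappa) Scheck,
        radial_limit_set Rlow = Stilde,
        Stilde = Scheck &
        Scheck = radial_limit_set Rup].
Proof.
set F := kolmogorov f.
have beta : condition_beta f kappa.
  by case: f_alpha_or_beta => // /(condition_alpha_beta F_retro).
have [/andP[eps0 eps1] f_gt1] := eps_small.
have FL x : Lambda kappa x -> Lambda kappa (F x).
  exact: kolmogorov_Lambda beta.
have lowS n : S_lower f eps n.+1 = F @` S_lower f eps n.
  by rewrite /S_lower -image_comp.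
have upS n : S_upper f kappa n.+1 = F @` S_upper f kappa n.
  by rewrite /S_upper -image_comp.
have low0 x : S_lower f eps 0 x -> Cplus x /\ \sum_i x 0 i = eps.
  move=> [_ [u Du <-] <-]; split; last exact: sum_scale_Delta.
  by move=> i; rewrite mxE mulr_ge0// ?(ltW eps0)//; case: Du.
have lowL n : S_lower f eps n `<=` Lambda kappa.
  elim: n => [x /low0[Cx sx]|n IH]; last by rewrite lowS => _ [x /IH/FL Lx <-].
  split=> // i; rewrite mxE; first exact: Cx.
  have : x 0 i <= \sum_i x 0 i 
    by rewrite (bigD1 i) //= lerDl; apply: sumr_ge0 => j _; exact: Cx.
  by rewrite sx; lra.
have upL n : S_upper f kappa n `<=` Lambda kappa.
  elim: n => [_ [x [Lx _] <-]|n IH] //; by rewrite upS => _ [x /IH/FL Lx <-].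
(* Two comparable points of a level set of the coordinate sum are equal. *)
have lowfree n : below_free (S_lower f eps n).
  elim: n => [x y /low0[Cx sx] /low0[Cy sy] [[xy x_neq_y] _]|n IH].
    apply: x_neq_y; apply/rowP => i; apply/eqP; rewrite eq_sym -subr_eq0.
    have : \sum_j (y 0 j - x 0 j) = 0 by rewrite sumrB sx sy subrr.
    move/eqP; rewrite psumr_eq0 => [/allP/(_ i)|j _]; last by rewrite subr_ge0.
    by rewrite mem_index_enum => /(_ isT).
  by rewrite lowS; exact: below_free_image F_retro (lowL n) IH.
(* A coordinate equal to [1 + kappa] cannot be strictly increased in the box. *)
have upfree n : below_free (S_upper f kappa n).
  elim: n => [_ _ [x [Lx [k xk]] <-] [y [Ly _] <-] [[xy _] lt]|n IH].
    have yk : y 0 k = 1 + kappa by apply: le_anti; rewrite (Lambda_le k Ly) -xk xy.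
    by have := lt k; rewrite /= xk yk ltxx => /(_ ltac:(lra)).
  by rewrite upS; exact: below_free_image F_retro (upL n) IH.
have Rlow0 u : Delta u -> Rlow 0 u = eps.
  move=> Du; have [_ <-] := low0 _ (radial_mem (Rlow_rep 0%N) Du).
  by rewrite sum_scale_Delta.
(* [S^0] is the outer boundary of the box, so it bounds the part of each ray
   inside the box; this starts both inductions that involve [Rup]. *)
have le_Rup0 (t : R) u : Delta u -> Lambda kappa (t *: u) -> t <= Rup 0 u.
  move=> Du Ltu; have [x [_ [k xk]] /= xE] := radial_mem (Rup_rep 0%N) Du.
  have uk : 0 < u 0 k.
    have [u0 _] := Du; rewrite lt_neqAle u0 andbT; apply/eqP => uk.
    by move: xk; rewrite xE mxE -uk mulr0; lra.
  rewrite -(ler_pM2r uk); have := Lambda_le k Ltu.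
  by rewrite -xk xE !mxE.
(* All rates exceed 1 on [S_0], so the first iterate has larger coordinate
   sums. *)
have Rlow_incr n u : Delta u -> Rlow n u <= Rlow n.+1 u.
  elim: n u => [u Du|n IH].
    have := radial_mem (Rlow_rep 1%N) Du; rewrite lowS => -[x Sx Fx].
    have [Cx sx] := low0 x Sx.
    rewrite Rlow0 // -sx -(sum_scale_Delta (Rlow 1%N u) Du) -Fx.
    apply: ler_sum => i _; rewrite mxE ler_peMr ?Cx// ltW//.
    by apply: f_gt1 => //; rewrite sx.
  have := Rlow_rep n.+2; have := Rlow_rep n.+1; rewrite lowS => r1.
  rewrite lowS => r2.
  exact: (radial_le_image f_pos F_retro (lowL n) (lowL n.+1)
    (lowfree n) (Rlow_rep n) (Rlow_rep n.+1) r1 r2 IH).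
have Rup_decr n u : Delta u -> Rup n.+1 u <= Rup n u.
  elim: n u => [u Du|n IH].
    by apply: le_Rup0 => //; exact: upL (radial_mem (Rup_rep 1%N) Du).
  have := Rup_rep n.+2; have := Rup_rep n.+1; rewrite upS => r1.
  rewrite upS => r2.
  exact: (radial_le_image f_pos F_retro (upL n.+1) (upL n)
    (upfree n.+1) (Rup_rep n.+1) (Rup_rep n) r2 r1 IH).
have Rlow_le_Rup n u : Delta u -> Rlow n u <= Rup n u.
  elim: n u => [u Du|n IH].
    by apply: le_Rup0 => //; exact: lowL (radial_mem (Rlow_rep 0%N) Du).
  have := Rup_rep n.+1; have := Rlow_rep n.+1; rewrite lowS => r1.
  rewrite upS => r2.
  exact: (radial_le_image f_pos F_retro (lowL n) (upL n)
    (lowfree n) (Rlow_rep n) (Rup_rep n) r1 r2 IH).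
have Rlow_mono u : Delta u -> nondecreasing_seq (Rlow^~ u).
  by move=> Du; apply/nondecreasing_seqP => n; exact: Rlow_incr.
have Rup_mono u : Delta u -> nonincreasing_seq (Rup^~ u).
  by move=> Du; apply/nonincreasing_seqP => n; exact: Rup_decr.
have Rlow_le_Rup_any m n u : Delta u -> Rlow n u <= Rup m u.
  move=> Du; apply: (le_trans (Rlow_mono u Du _ _ (leq_maxl n m))).
  apply: (le_trans (Rlow_le_Rup _ u Du)).
  exact: Rup_mono (leq_maxr n m).
have eps_le_Rlow n u : Delta u -> eps <= Rlow n u.
  by move=> Du; rewrite -(Rlow0 u Du); exact: Rlow_mono.
have Rlow_cvg u : Delta u -> cvgn (Rlow^~ u).
  move=> Du; apply: nondecreasing_is_cvgn (Rlow_mono u Du) _.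
  by exists (Rup 0 u) => _ [n _ <-]; exact: Rlow_le_Rup_any.
have Rup_cvg u : Delta u -> cvgn (Rup^~ u).
  move=> Du; apply: nonincreasing_is_cvgn (Rup_mono u Du) _.
  by exists eps => _ [n _ <-]; rewrite -(Rlow0 u Du); exact: Rlow_le_Rup_any.
pose A := outer_limit (S_lower f eps); pose B := outer_limit (S_upper f kappa).
have Fcont : {within Lambda kappa, continuous F} by exact: kolmogorov_continuous.
have hausd := @norm_hausdorff R 'rV[R]_d.
have A_mem u : Delta u -> A (limn (Rlow^~ u) *: u).
  move=> Du; apply: (@outer_limit_cvg _ _ (fun n => Rlow n u *: u)).
    by move=> n; exact: radial_mem.
  by apply: cvgZr_tmp; exact: Rlow_cvg.
have B_mem u : Delta u -> B (limn (Rup^~ u) *: u).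
  move=> Du; apply: (@outer_limit_cvg _ _ (fun n => Rup n u *: u)).
    by move=> n; exact: radial_mem.
  by apply: cvgZr_tmp; exact: Rup_cvg.
have Asum : A `<=` [set y | eps <= \sum_i y 0 i].
  apply: outer_limit_sub => [|n y].
    apply: (@preimage_closed _ _ (fun y : 'rV[R]_d => \sum_i y 0 i) [set t | eps <= t]).
      by move=> y _; exact: sum_coord_continuous.
    exact: closed_ge.
  have [_ _ ->] := Rlow_rep n; move=> [u Du <-] /=.
  by rewrite sum_scale_Delta// eps_le_Rlow.
have lim_eq u : Delta u -> limn (Rup^~ u) = limn (Rlow^~ u).
  move=> Du; apply: le_anti; apply/andP; split; last first.
    apply: ler_lim; [exact: Rlow_cvg|exact: Rup_cvg|].
    by near=> n; exact: Rlow_le_Rup.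
  have lim0 : 0 < limn (Rlow^~ u).
    apply: (lt_le_trans eps0); apply: limr_ge; first exact: Rlow_cvg.
    by near=> n; exact: eps_le_Rlow.
  (* The ratio of the two points on the ray of [u] is the quotient of the radii. *)
  rewrite -[leRHS]mul1r -ler_pdivrMr //.
  apply: (@backward_invariant_le _ _ f kappa A B eps f_pos beta eps0)
    (A_mem u Du) (B_mem u Du) _.
  - exact: closed_outer_limit.
  - exact: closed_outer_limit.
  - exact: outer_limit_sub (@Lambda_closed _ _ kappa) lowL.
  - exact: outer_limit_sub (@Lambda_closed _ _ kappa) upL.
  - exact: Asum.
  - move=> x.
    exact: outer_limit_preimage hausd (@Lambda_compact _ _ kappa) Fcont lowL lowS.
  - move=> x.
    exact: outer_limit_preimage hausd (@Lambda_compact _ _ kappa) Fcont upL upS.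
  - by move=> i; rewrite !mxE mulrA divfK ?gt_eqF.
have Rlow_rad_cont n : {within @Delta R d, continuous (Rlow n)}.
  by have [] := Rlow_rep n.
have Rup_rad_cont n : {within @Delta R d, continuous (Rup n)}.
  by have [] := Rup_rep n.
have Rup_to u : Delta u -> Rup n u @[n --> \oo] --> limn (Rlow^~ u).
  by move=> Du; rewrite -lim_eq //; exact: Rup_cvg.
exists (radial_limit_set Rlow), (radial_limit_set Rlow).
split=> //.
- apply: (@kuratowski_limit_squeeze _ _ Rlow Rlow Rup) eps0 _ _ _ _ _ _ _ => //.
  + by move=> n; have [] := Rlow_rep n.
  + by move=> m n u mn Du; rewrite Rlow_mono// Rlow_le_Rup_any.
- apply: (@kuratowski_limit_squeeze _ _ Rup Rlow Rup) eps0 _ _ _ _ _ _ _ => //.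
  + by move=> n; have [] := Rup_rep n.
  + by move=> n u Du; rewrite -(Rlow0 u Du); exact: Rlow_le_Rup_any.
  + by move=> m n u mn Du; rewrite Rlow_le_Rup_any// Rup_mono.
- by apply: eq_imagel => u Du; rewrite lim_eq.
Unshelve. all: by end_near. Qed.
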